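(* Let $W\subseteq\mathbb{R}^n$ be a linear subspace and $c,d,\tilde d\in\mathbb{R}^n$, and assume that Primal-Dual$(W,d,c)$ is feasible (both its primal and its dual program). Let $(\tilde x,s)$ be an optimal solution to Primal-Dual$(W,\tilde d,c)$, and let $\tau\ge(\kappa_W+1)\|d-\tilde d\|_1$ and $T\ge(2n\kappa_W+1)\tau$. Partition $[n]$ as $$I_L=\{i:\tilde x_i>T\},\quad I_M=\{i: T\ge\tilde x_i>\tau\},\quad I_S=\{i:\tau\ge\tilde x_i\},$$ and further partition $I_S$ as $I_S^0=I_S\cap\operatorname{cl}(I_L)$ and $I_S^+=I_S\setminus\operatorname{cl}(I_L)$. Then there exists a primal optimal solution $x''$ to Primal-Dual$(W,d,c)$ such that $x''_i>0$ for all $i\in I_L\cup I_M$ and $x''_i=0$ for all $i\in I_S^0$.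
   Context: For a subspace $W\subseteq\mathbb{R}^n$ and $d,c\in\mathbb{R}^n$, Primal-Dual$(W,d,c)$ is the pair of programs: primal $\min\langle c,x\rangle$ s.t. $x\in W+d$, $x\ge0$; dual $\max\langle d,c-s\rangle$ s.t. $s\in W^\perp+c$, $s\ge0$. A pair $(x,s)$ is optimal iff $x$ is primal feasible, $s$ is dual feasible and $\langle x,s\rangle=0$. A circuit of $W$ is an inclusion-wise minimal nonempty set $C\subseteq[n]$ that is the support of a vector of $W$; let $g^C\in W$ with $\operatorname{supp}(g^C)=C$ (unique up to scaling), and let $\mathcal{C}_W$ be the set of circuits. If $W=\ker(A)$, the circuits are the minimal dependent sets of columns of $A$. The circuit imbalance measure is $\kappa_W=\max\{\max_{i\in C}|g^C_i|/\min_{j\in C}|g^C_j| : C\in\mathcal{C}_W\}$ (take $\kappa_W=1$ if $W=\{0\}$). For $I\subseteq[n]$, the closure is $\operatorname{cl}(I)=I\cup\{j\in[n]\setminus I:\exists C\in\mathcal{C}_W,\ j\in C\subseteq I\cup\{j\}\}$ (closure in the linear matroid of the columns of $A$ when $W=\ker(A)$). *)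

(* Defs.v *)
From mathcomp Require Import boolp classical_sets reals.
From mathcomp Require Import all_boot all_order all_algebra.

Set Implicit Arguments.
Unset Strict Implicit.
Unset Printing Implicit Defensive.

Import Order.TTheory GRing.Theory Num.Theory.
Local Open Scope ring_scope.

Section PrimalDual.
Variables (R : realType) (n : nat).
Implicit Types (W : {vspace 'rV[R]_n}) (x y s c d w : 'rV[R]_n).

Definition dot x y : R := \sum_(i < n) x 0 i * y 0 i.

Definition l1norm x : R := \sum_(i < n) `|x 0 i|.

Definition nonneg x : Prop := forall i, 0 <= x 0 i.

Definition in_orth W y : Prop := forall w, w \in W -> dot w y = 0.

Definition primal_feasible W d x : Prop := x - d \in W /\ nonneg x.

Definition dual_feasible W c s : Prop := in_orth W (s - c) /\ nonneg s.

Definition pd_feasible W d c : Prop :=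
  (exists x, primal_feasible W d x) /\ (exists s, dual_feasible W c s).

Definition pd_optimal W d c x s : Prop :=
  [/\ primal_feasible W d x, dual_feasible W c s & dot x s = 0].

Definition primal_optimal W d c x : Prop :=
  primal_feasible W d x /\
  (forall y, primal_feasible W d y -> dot c x <= dot c y).

End PrimalDual.

Section Circuits.
Variables (R : realType) (n : nat).
Implicit Types (W : {vspace 'rV[R]_n}) (g : 'rV[R]_n) (C I : {set 'I_n}).

Definition supp g : {set 'I_n} := [set i | g 0 i != 0].

Definition is_support W C : Prop := exists2 g, g \in W & supp g = C.

Definition circuits W : {set {set 'I_n}} :=
  [set C | minset (fun D => (D != set0) && `[< is_support W D >]) C].

(* Some g^C; the value 0 is only taken when C is not a support in W. *)
Definition circuit_vec W C : 'rV[R]_n :=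
  xget 0 [set g | g \in W /\ supp g = C]%classic.

Definition max_entry g C : R := \big[Num.max/0]_(i in C) `|g 0 i|.

(* Starting from [max_entry g C] does not affect the minimum when C is
   nonempty. *)
Definition min_entry g C : R :=
  \big[Num.min/max_entry g C]_(i in C) `|g 0 i|.

(* The ratios are all at least 1, so starting from 1 only matters when there
   is no circuit, i.e. when W = 0. *)
Definition kappa W : R :=
  \big[Num.max/1]_(C in circuits W)
    (max_entry (circuit_vec W C) C / min_entry (circuit_vec W C) C).

Definition cl W I : {set 'I_n} :=
  I :|: [set j in ~: I | [exists C in circuits W,
                            (j \in C) && (C \subset j |: I)]].

End Circuits.

Section Partition.
Variables (R : realType) (n : nat).
Implicit Types (W : {vspace 'rV[R]_n}) (x : 'rV[R]_n) (tau T : R).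

Definition I_L x T : {set 'I_n} := [set i | T < x 0 i].
Definition I_M x tau T : {set 'I_n} := [set i | tau < x 0 i <= T].
Definition I_S x tau : {set 'I_n} := [set i | x 0 i <= tau].
Definition I_S0 W x tau T : {set 'I_n} := I_S x tau :&: cl W (I_L x T).

End Partition.

(* Main.v *)
From mathcomp Require Import boolp classical_sets.
Require Import Defs.
From mathcomp Require Import all_boot all_order all_algebra.
From mathcomp Require Import reals ring lra.

(** The dual solution [s] stays feasible when [d'] is replaced by [d], and on
    directions in [W] the objective [c] coincides with [s].  The proof has two
    halves.

    Proximity ([primal_proximity]): the program for [d] has an optimal
    solution [x] whose entries all differ from those of [x'] by at most
    [(kappa W + 1) * l1norm (d - d') <= tau].  An arbitrary optimal solution
    [x2] exists, since the optimum is attained among the finitely many basic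
    points.  Move [x2] towards [x'] by removing from [x2 - x'] as many
    sign-compatible directions of [W] as possible ([splits_cancel]).
    Feasibility survives because every entry stays between its values in [x']
    and [x2]; the removed direction [h] has nonnegative cost, since [x' + h] is
    feasible for [d'], where [x'] is optimal.  What remains of [x2 - x'] is a
    vector [y] with no conformal direction of [W].  It differs by [d - d'] from
    an element [w] of [W], and each circuit in a conformal decomposition of [w]
    must use an index at which [w] and [y] do not have the same sign.  There
    [|w|] is at most [|d - d'|], so the circuit imbalance bounds all entries of
    [w], hence of [y] ([irreducible_bound]).

    Rounding: [x] is positive where [x' > tau] and is at most [2 * tau] on the
    small indices.  A small index [j] in the closure of [I_L] lies on a circuit
    whose other indices are in [I_L]; subtracting [x 0 j] times its vector
    normalised to be 1 at [j] ([cl_exchange]) sets entry [j] to zero and changes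
    entries in [I_L] by at most [2 * tau * kappa W].  The at most [n] such
    changes add up to at most [T - tau], so [I_L] stays positive.  As
    [s] vanishes on [I_L], each subtraction changes the cost by
    [- x 0 j * s 0 j <= 0], so optimality is preserved. *)

Import Order.TTheory GRing.Theory Num.Theory.
Local Open Scope ring_scope.

(** * Conformal vectors and the ratio test *)

Section Conformal.
Variables (R : realType) (n : nat).
Implicit Types (W : {vspace 'rV[R]_n}) (c d g h s u w x y z : 'rV[R]_n).
Implicit Types (i j : 'I_n) (t : R) (C J : {set 'I_n}).

Lemma mem_supp w i : (i \in supp w) = (w 0 i != 0).
Proof. by rewrite inE. Qed.

Lemma supp_neq0 w : (supp w != set0) = (w != 0).
Proof.
apply/set0Pn/idP => [[i] | ].
  by rewrite mem_supp; apply: contraNneq => ->; rewrite mxE.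
move=> /eqP w0; apply: contrapT => nw; apply: w0; apply/rowP => i; rewrite mxE.
by apply/eqP/negP => /negP wi; apply: nw; exists i; rewrite mem_supp.
Qed.

Lemma suppN w : supp (- w) = supp w.
Proof. by apply/setP => i; rewrite !mem_supp mxE oppr_eq0. Qed.

Lemma mul_gt0_neq0 (a b : R) : 0 < a * b -> a != 0 /\ b != 0.
Proof.
by move=> ab; split; apply: contraTneq ab => ->; rewrite ?mulr0 ?mul0r ltxx.
Qed.

Lemma mul_gt0_trans (b a e : R) : 0 < a * b -> 0 < b * e -> 0 < a * e.
Proof.
move=> ab be; have [_ b0] := mul_gt0_neq0 _ _ ab.
have : 0 < b ^+ 2 * (a * e).
  by have := mulr_gt0 ab be; congr (_ < _); ring.
by rewrite pmulr_rgt0 // exprn_even_gt0.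
Qed.

(** Conformality is by sign only: [u] may exceed [w] in absolute value. *)
Definition conformal u w := forall i, u 0 i != 0 -> 0 < u 0 i * w 0 i.

Lemma conformal_trans v u w :
  conformal u v -> conformal v w -> conformal u w.
Proof.
move=> cuv cvw i ui; have uv := cuv i ui.
apply: (mul_gt0_trans _ _ _ uv); apply: cvw.
by case: (mul_gt0_neq0 _ _ uv).
Qed.

Lemma conformal_subset u w : conformal u w -> supp u \subset supp w.
Proof.
move=> cuw; apply/subsetP => i; rewrite !mem_supp => /cuw.
by apply: contraTneq => ->; rewrite mulr0 ltxx.
Qed.

(** Moving from [w] along [- g] until the first entry vanishes.  Only the
    entries in which [g] and [w] agree in sign move towards 0, so the step is
    the smallest ratio over these. *)
Lemma ratio_test g w : supp g \subset supp w ->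
    (exists i, 0 < g 0 i * w 0 i) ->
  exists t, [/\ 0 < t, conformal (w - t *: g) w
              & supp (w - t *: g) \proper supp w].
Proof.
move=> sgw [i0 Pi0].
case: (@arg_minP _ _ _ i0 (fun i => 0 < g 0 i * w 0 i)
         (fun i => w 0 i / g 0 i) Pi0) => k Pk kmin.
have divE i : 0 < g 0 i * w 0 i -> w 0 i = (w 0 i / g 0 i) * g 0 i.
  by move=> Pi; rewrite divfK //; case: (mul_gt0_neq0 _ _ Pi).
set t := w 0 k / g 0 k in kmin *.
have [gk wk] := mul_gt0_neq0 _ _ Pk.
have t0 : 0 < t.
  have : 0 < t * (g 0 k) ^+ 2 by rewrite expr2 mulrA -divE // mulrC.
  by rewrite pmulr_lgt0 // exprn_even_gt0.
have cw : conformal (w - t *: g) w.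
  move=> i; rewrite !mxE => ni.
  case: (ltrP 0 (g 0 i * w 0 i)) => [Pi|Ni].
    have [_ wi] := mul_gt0_neq0 _ _ Pi; rewrite lt_def mulf_neq0 //=.
    rewrite {1}(divE i Pi) -mulrBl -mulrA mulr_ge0 ?subr_ge0 ?kmin //.
    exact: ltW.
  have wi : w 0 i != 0.
    apply: contraNneq ni => wi; have [->|gi] := eqVneq (g 0 i) 0.
      by rewrite wi mulr0 subr0.
    have : i \in supp w by apply: (subsetP sgw); rewrite mem_supp.
    by rewrite mem_supp wi eqxx.
  have w2 : 0 < w 0 i * w 0 i by rewrite -expr2 exprn_even_gt0.
  have tN : t * (g 0 i * w 0 i) <= 0 by rewrite pmulr_rle0.
  lra.
exists t; split => //; apply/properP; split; first exact: conformal_subset.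
exists k; rewrite mem_supp //.
by rewrite !mxE -divE // subrr eqxx.
Qed.

(** Entrywise, [h] lies between 0 and [y].  The equality of absolute values
    makes this relation additive, which is how bounds are accumulated along a
    sequence of peeling steps. *)
Definition splits h y := forall i, `|h 0 i| + `|y 0 i - h 0 i| = `|y 0 i|.

Lemma normD_same_sign (a b : R) : 0 <= a * b -> `|a| + `|b| = `|a + b|.
Proof.
move=> ab; have [a0|a0|<-] := ltgtP 0 a.
- have b0 : 0 <= b by move: ab; rewrite pmulr_rge0.
  by rewrite !ger0_norm // ?addr_ge0 // ltW.
- have b0 : b <= 0 by move: ab; rewrite nmulr_rge0.
  by rewrite !ler0_norm ?opprD // -?oppr_ge0 ?opprD ?addr_ge0 ?oppr_ge0 // ltW.
- by rewrite normr0 !add0r.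
Qed.

Lemma conformal_peel g y : g != 0 -> conformal g y ->
  exists t, [/\ splits (t *: g) y, conformal (y - t *: g) y
              & supp (y - t *: g) \proper supp y].
Proof.
move=> g0 cgy.
have [i gi] : exists i, i \in supp g by apply/set0Pn; rewrite supp_neq0.
have [|t [t0 cy py]] := ratio_test g y (conformal_subset _ _ cgy).
  by exists i; apply: cgy; rewrite -mem_supp.
exists t; split => // k.
have -> : y 0 k - (t *: g) 0 k = (y - t *: g) 0 k by rewrite !mxE.
rewrite normD_same_sign; first by rewrite addrC !mxE subrK.
have [->|nk] := eqVneq ((y - t *: g) 0 k) 0; first by rewrite mulr0.
have [gk|gk] := eqVneq (g 0 k) 0; first by rewrite !mxE gk mulr0 mul0r.
rewrite [X in X * _]mxE -mulrA mulr_ge0 ?ltW //.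
by apply: (mul_gt0_trans (y 0 k)); [exact: cgy | rewrite mulrC; exact: cy].
Qed.

(** * Circuits and the circuit imbalance *)

Lemma circuits_min W C : C \in circuits W ->
  (exists2 g, g \in W & supp g = C) /\
  (forall w, w \in W -> w != 0 -> supp w \subset C -> supp w = C).
Proof.
rewrite inE => /minsetP[/andP[C0 /asboolP sC] Cmin]; split => // w wW w0 swC.
by apply: Cmin => //; rewrite supp_neq0 w0; apply/asboolP; exists w.
Qed.

Lemma circuit_neq0 W g : supp g \in circuits W -> g != 0.
Proof. by rewrite -supp_neq0 inE => /minsetP[/andP[]]. Qed.

Lemma exists_circuit W w : w \in W -> w != 0 ->
  exists g, [/\ g \in W, supp g \in circuits W & supp g \subset supp w].
Proof.
move=> wW w0.
have [|C mC sC] := @minset_exists _ 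
    (fun D => (D != set0) && `[< is_support W D >]) (supp w).
  by rewrite supp_neq0 w0; apply/asboolP; exists w.
have Cc : C \in circuits W by rewrite inE.
by have [[g gW gC] _] := circuits_min W C Cc; exists g; rewrite gC.
Qed.

(** If a circuit inside the support of [w] is not itself conformal to [w], the
    ratio test along it leaves a nonzero vector of smaller support conformal
    to [w], and a circuit conformal to that vector will do. *)
Lemma exists_conformal_circuit W w : w \in W -> w != 0 ->
  exists g, [/\ g \in W, supp g \in circuits W & conformal g w].
Proof.
have [m] := ubnP #|supp w|; elim: m w => // m IH w wm wW w0.
have [g0 [g0W g0C sg0]] := exists_circuit W w wW w0.
have g0n0 := circuit_neq0 W g0 g0C.
have [i gi] : exists i, i \in supp g0 by apply/set0Pn; rewrite supp_neq0.
have [g [gW gC sg gw]] : exists g, [/\ g \in W, supp g \in circuits W,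
    supp g \subset supp w & exists k, 0 < g 0 k * w 0 k].
  have wi := subsetP sg0 i gi; rewrite !mem_supp in gi wi.
  case: (ltrgt0P (g0 0 i * w 0 i)) => [p|p|/eqP].
  - by exists g0; split => //; exists i.
  - exists (- g0); rewrite suppN rpredN; split => //; exists i.
    by rewrite mxE mulNr oppr_gt0.
  - by rewrite mulf_eq0 (negbTE gi) (negbTE wi).
have [t [t0 cw pw]] := ratio_test g w sg gw.
have [w'0|w'n0] := eqVneq (w - t *: g) 0.
  have wE : w = t *: g by apply/eqP; rewrite -subr_eq0 w'0.
  exists g; split => // k gk; rewrite wE mxE mulrCA mulr_gt0 //.
  by rewrite -expr2 exprn_even_gt0.
have [||h [hW hC ch]] := IH (w - t *: g) _ _ w'n0.
- exact: leq_trans (proper_card pw) _.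
- by rewrite rpredB // rpredZ.
- by exists h; split => //; apply: conformal_trans ch cw.
Qed.

Lemma kappa_ge1 W : 1 <= kappa W.
Proof. exact: bigmax_ge_id. Qed.

(** The measure is defined from one chosen vector per circuit; minimality of
    the circuit makes any other vector with this support a multiple of it. *)
Lemma kappa_bound W g i j : g \in W -> supp g \in circuits W ->
  j \in supp g -> `|g 0 i| <= kappa W * `|g 0 j|.
Proof.
move=> gW gC gj; set C := supp g.
have [_ Cmin] := circuits_min W C gC.
pose v := circuit_vec W C.
have [vW vC] : v \in W /\ supp v = C.
  rewrite /v /circuit_vec.
  by case: xgetP => [_ _ []//|/(_ g)[]].
have k0 : 0 <= kappa W := le_trans ler01 (kappa_ge1 W).
have vj : v 0 j != 0 by rewrite -mem_supp vC.
(* The difference vanishes at [j], so its support is properly inside [C]. *)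
have gE : g = (g 0 j / v 0 j) *: v.
  apply/eqP; rewrite -subr_eq0; apply/negPn/negP => ne0.
  have /(_ _ ne0) sE := Cmin (g - (g 0 j / v 0 j) *: v).
  have : j \in supp (g - (g 0 j / v 0 j) *: v).
    rewrite sE //; first by rewrite rpredB // rpredZ.
    apply/subsetP => k; rewrite !mem_supp !mxE; apply: contraNT => /negPn/eqP gk.
    have : k \notin supp v by rewrite vC mem_supp gk eqxx.
    by rewrite mem_supp negbK gk => /eqP ->; rewrite mulr0 subrr.
  by rewrite mem_supp !mxE divfK // subrr eqxx.
suff vb : `|v 0 i| <= kappa W * `|v 0 j|.
  move: gE; set a := g 0 j / v 0 j => ->.
  by rewrite !mxE !normrM mulrCA ler_wpM2l ?mulr_ge0.
have [iC|niC] := boolP (i \in C); last first.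
  by move: niC; rewrite -vC mem_supp negbK => /eqP ->; rewrite normr0 mulr_ge0.
have jC : j \in C by [].
have max_le : `|v 0 i| <= max_entry v C.
  by rewrite /max_entry; apply: (le_bigmax_cond _ (fun i => `|v 0 i|)).
have min_le : min_entry v C <= `|v 0 j|.
  by rewrite /min_entry; apply: (bigmin_le_cond _ (fun i => `|v 0 i|)).
have min_gt0 : 0 < min_entry v C.
  apply/bigmin_gtP; split => [|k]; last by rewrite -vC mem_supp normr_gt0.
  apply: lt_le_trans (_ : `|v 0 j| <= _); first by rewrite normr_gt0.
  by apply: (le_bigmax_cond _ (fun i => `|v 0 i|)).
have : max_entry v C / min_entry v C <= kappa W.
  by apply: (le_bigmax_cond _ (fun D =>
    max_entry (circuit_vec W D) D / min_entry (circuit_vec W D) D)).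
rewrite ler_pdivrMr // => maxb.
apply: le_trans max_le _; apply: le_trans maxb _.
by rewrite ler_wpM2l.
Qed.

(** Peel conformal circuit vectors off [w] until nothing is left.  Absolute
    values add up along the way, and each peeled vector is bounded by [kappa W]
    times its own entry at an index of [J]. *)
Lemma norm_le_circuit_transversal W w J : w \in W ->
    (forall g, g \in W -> supp g \in circuits W -> conformal g w ->
       exists2 j, j \in J & j \in supp g) ->
  forall i, `|w 0 i| <= kappa W * \sum_(j in J) `|w 0 j|.
Proof.
have [m] := ubnP #|supp w|; elim: m w => // m IH w wm wW hit i.
have k0 : 0 <= kappa W := le_trans ler01 (kappa_ge1 W).
have [->|w0] := eqVneq w 0.
  by rewrite mxE normr0 mulr_ge0 // sumr_ge0.
have [g [gW gC cg]] := exists_conformal_circuit W w wW w0.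
have g0 := circuit_neq0 W g gC.
have [t [sp cw pw]] := conformal_peel g w g0 cg.
have IHw : forall k, `|(w - t *: g) 0 k| <=
    kappa W * \sum_(j in J) `|(w - t *: g) 0 j|.
  apply: IH; first exact: leq_trans (proper_card pw) _.
    by rewrite rpredB // rpredZ.
  by move=> h hW hC ch; apply: hit => //; apply: conformal_trans ch cw.
have [j jJ gj] := hit g gW gC cg.
have tgb : `|(t *: g) 0 i| <= kappa W * \sum_(j in J) `|(t *: g) 0 j|.
  apply: le_trans (_ : kappa W * `|(t *: g) 0 j| <= _).
    by rewrite !mxE !normrM mulrCA ler_wpM2l // kappa_bound.
  rewrite ler_wpM2l // (bigD1 j) //= lerDl sumr_ge0 //.
rewrite -sp; under eq_bigr do rewrite -sp.
rewrite big_split /= mulrDr lerD //.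
have := IHw i; rewrite !mxE; congr (_ <= _ * _).
by apply: eq_bigr => k _; rewrite !mxE.
Qed.

(** * Proximity of a conformally irreducible vector *)

(** Each cancellation of a conformal direction shrinks the support, so the
    process stops, without any compactness argument. *)
Lemma splits_cancel W y : exists h, [/\ h \in W, splits h y
  & forall g, g \in W -> g != 0 -> ~ conformal g (y - h)].
Proof.
have [m] := ubnP #|supp y|; elim: m y => // m IH y ym.
have [[g [gW g0 cg]]|no] :=
  pselect (exists g, [/\ g \in W, g != 0 & conformal g y]).
  have [t [sp _ py]] := conformal_peel g y g0 cg.
  have [|h [hW hs hirr]] := IH (y - t *: g).
    exact: leq_trans (proper_card py) _.
  exists (t *: g + h); split; first by rewrite rpredD // rpredZ.
    move=> i; have := sp i; have := hs i; rewrite !mxE.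
    set a := t * _; set b := h 0 i; set e := y 0 i => hs' sp'.
    apply/eqP; rewrite eq_le; apply/andP; split.
      have := ler_normD a b; rewrite opprD addrA; lra.
    by have := ler_normD (a + b) (e - (a + b)); rewrite [in leLHS]addrC subrK.
  by move=> f fW f0; rewrite opprD addrA; apply: hirr.
exists 0; split; first exact: rpred0.
  by move=> i; rewrite mxE normr0 subr0 add0r.
by move=> g gW g0; rewrite subr0 => cg; apply: no; exists g.
Qed.

(** A circuit vector conformal to [w] cannot be conformal to [y], so it meets
    the set [J] of indices at which [w] and [y] are not of the same strict
    sign; on [J], the distance from [w] to [y] is at least [|w|]. *)
Lemma irreducible_bound W y w : w \in W ->
    (forall g, g \in W -> g != 0 -> ~ conformal g y) ->
  forall i, `|y 0 i| <= (kappa W + 1) * l1norm (y - w).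
Proof.
move=> wW irr i; pose J := [set j : 'I_n | w 0 j * y 0 j <= 0]%SET.
have k0 : 0 <= kappa W := le_trans ler01 (kappa_ge1 W).
have wb : `|w 0 i| <= kappa W * \sum_(j in J) `|w 0 j|.
  apply: norm_le_circuit_transversal => // g gW gC cg.
  apply: contrapT => nJ.
  apply: (irr g gW (circuit_neq0 W g gC)) => j gj.
  apply: (mul_gt0_trans (w 0 j)); first exact: cg.
  rewrite ltNge; apply/negP => wy; apply: nJ; exists j; rewrite ?mem_supp //.
  by rewrite inE.
have Jb : \sum_(j in J) `|w 0 j| <= l1norm (y - w).
  rewrite /l1norm (bigID (mem J) predT) /= -[leLHS]addr0 lerD //; last first.
    exact: sumr_ge0.
  apply: ler_sum => j; rewrite inE !mxE => wy.
  rewrite [y 0 j + _]addrC -normD_same_sign; first by rewrite normrN lerDl.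
  by rewrite mulNr oppr_ge0.
have dl : `|(y - w) 0 i| <= l1norm (y - w).
  by rewrite /l1norm (bigD1 i) //= lerDl sumr_ge0.
have := ler_normD (w 0 i) ((y - w) 0 i).
have -> : w 0 i + (y - w) 0 i = y 0 i by rewrite !mxE addrCA subrr addr0.
move=> yb.
have := ler_wpM2l k0 Jb; lra.
Qed.


(** * Attainment of the primal optimum *)

Lemma dotDr x y z : dot x (y + z) = dot x y + dot x z.
Proof.
by rewrite /dot -big_split; apply: eq_bigr => i _; rewrite mxE mulrDr.
Qed.

Lemma dotC x y : dot x y = dot y x.
Proof. by apply: eq_bigr => i _; rewrite mulrC. Qed.

Lemma dotZr t x y : dot x (t *: y) = t * dot x y.
Proof.
by rewrite /dot mulr_sumr; apply: eq_bigr => i _; rewrite mxE mulrCA.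
Qed.

Lemma dotNr x y : dot x (- y) = - dot x y.
Proof. by rewrite -scaleN1r dotZr mulN1r. Qed.

Lemma dotBr x y z : dot x (y - z) = dot x y - dot x z.
Proof. by rewrite dotDr dotNr. Qed.

Lemma dot0r x : dot x 0 = 0.
Proof. by rewrite -(scale0r 0) dotZr mul0r. Qed.

Lemma dot_sumr (I : finType) (P : pred I) x (F : I -> 'rV[R]_n) :
  dot x (\sum_(k | P k) F k) = \sum_(k | P k) dot x (F k).
Proof. by apply: (big_morph (dot x)) => [y z|]; rewrite ?dotDr ?dot0r. Qed.

Lemma dot_ge0 x y : nonneg x -> nonneg y -> 0 <= dot x y.
Proof. by move=> x0 y0; apply: sumr_ge0 => i _; rewrite mulr_ge0. Qed.

Lemma dual_feasible_dot W c s w : dual_feasible W c s -> w \in W ->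
  dot c w = dot s w.
Proof.
move=> [so _] wW; have := so w wW.
by rewrite dotBr ![dot w _]dotC => /eqP; rewrite subr_eq0 => /eqP.
Qed.

Lemma primal_feasibleD W d x w : primal_feasible W d x -> w \in W ->
  nonneg (x + w) -> primal_feasible W d (x + w).
Proof. by move=> [xW _] wW x0; split => //; rewrite addrAC rpredD. Qed.

(** The analogue of a basic solution when the subspace is not given by a
    matrix: the columns indexed by the support are independent. *)
Definition basic_point W x := forall w, w \in W -> supp w \subset supp x -> w = 0.

(** While the support carries a nonzero vector of [W], move along one of
    nonnegative cost until an entry vanishes.  Dual feasibility enters here:
    it forces a vector of positive cost to have a positive entry, so that the
    move is blocked by the nonnegativity constraints. *)
Lemma exists_basic_le W d c s x :
    dual_feasible W c s -> primal_feasible W d x ->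
  exists y, [/\ primal_feasible W d y, basic_point W y & dot c y <= dot c x].
Proof.
move=> ds; have [m] := ubnP #|supp x|; elim: m x => // m IH x xm px.
have [bx|nb] := pselect (basic_point W x); first by exists x.
have [g [gW g0 sg]] : exists g, [/\ g \in W, g != 0 & supp g \subset supp x].
  apply: contrapT => no; apply: nb => w wW sw.
  by apply/eqP/negPn/negP => w0; apply: no; exists w.
have [h [hW sh ch [i hi]]] : exists h, [/\ h \in W, supp h \subset supp x,
    0 <= dot c h & exists i, 0 < h 0 i].
  have pos w : w \in W -> 0 < dot c w -> exists i, 0 < w 0 i.
    move=> wW; rewrite (dual_feasible_dot _ _ _ _ ds wW) => sw.
    apply: contrapT => no; move: sw; apply/negP; rewrite -leNgt.
    rewrite -oppr_ge0 -dotNr; apply: dot_ge0; first by case: ds.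
    move=> i; rewrite mxE oppr_ge0 leNgt; apply/negP => wi; apply: no.
    by exists i.
  (* One of [g] and [- g] has nonnegative cost; at cost zero, the sign is
     chosen to get a positive entry. *)
  case: (ltrgt0P (dot c g)) => cg.
  - by exists g; split => //; [exact: ltW | exact: pos].
  - have cN : 0 < dot c (- g) by rewrite dotNr oppr_gt0.
    exists (- g); rewrite suppN rpredN; split => //; first exact: ltW.
    by apply: pos; rewrite ?rpredN.
  have [i gi] : exists i, i \in supp g by apply/set0Pn; rewrite supp_neq0.
  move: gi; rewrite mem_supp; case: (ltrgt0P (g 0 i)) => // gi _.
    by exists g; split; rewrite ?cg //; exists i.
  exists (- g); rewrite suppN rpredN dotNr cg oppr0; split => //; exists i.
  by rewrite mxE oppr_gt0.
have x0 : nonneg x by case: px.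
have xi : 0 < x 0 i.
  rewrite lt_def x0 andbT -mem_supp; apply: (subsetP sh).
  by rewrite mem_supp gt_eqF.
have [|t [t0 cx pr]] := ratio_test h x sh; first by exists i; rewrite mulr_gt0.
have pxt : primal_feasible W d (x - t *: h).
  apply: primal_feasibleD => //; first by rewrite rpredN rpredZ.
  move=> k; have [->//|nk] := eqVneq ((x - t *: h) 0 k) 0.
  have xk := cx k nk; have [_ xk0] := mul_gt0_neq0 _ _ xk.
  by move: xk; rewrite pmulr_lgt0 => [/ltW//|]; rewrite lt_def xk0 x0.
have [|//|y [py by1 cy]] := IH (x - t *: h).
  exact: leq_trans (proper_card pr) _.
exists y; split => //; apply: le_trans cy _.
by rewrite dotBr dotZr gerBl mulr_ge0 // ltW.
Qed.

(** A feasible basic point is determined by its support, so there are finitely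
    many of them and a cheapest one is optimal. *)
Lemma exists_primal_optimal W d c x s :
    primal_feasible W d x -> dual_feasible W c s ->
  exists y, primal_optimal W d c y.
Proof.
move=> px ds.
pose P (S : {set 'I_n}) y := [/\ primal_feasible W d y, basic_point W y & supp y = S].
pose sol S := xget 0 [set y | P S y]%classic.
pose Q S := `[< exists y, P S y >].
have solP S : Q S -> P S (sol S).
  by move=> /asboolP[y Py]; rewrite /sol; case: xgetP => [z _ //|/(_ y)[]].
have solE y : primal_feasible W d y -> basic_point W y ->
    Q (supp y) /\ sol (supp y) = y.
  move=> py by1; have Qy : Q (supp y) by apply/asboolP; exists y.
  split => //; have [[zW _] _ sz] := solP _ Qy.
  apply/eqP; rewrite -subr_eq0; apply/eqP/by1.
    have -> : sol (supp y) - y = (sol (supp y) - d) - (y - d).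
      by rewrite opprB addrA subrK.
    by rewrite rpredB //; case: py.
  apply/subsetP => i; rewrite [in X in _ -> X]mem_supp; apply: contraTneq => yi.
  have : i \notin supp (sol (supp y)) by rewrite sz mem_supp yi eqxx.
  by rewrite !mem_supp !mxE negbK yi => /eqP ->; rewrite subrr eqxx.
have [y0 [py0 by0 _]] := exists_basic_le W d c s x ds px.
have [Q0 _] := solE y0 py0 by0.
case: (@arg_minP _ _ _ (supp y0) Q (fun S => dot c (sol S)) Q0) => S QS Smin.
have [pS _ _] := solP S QS.
exists (sol S); split => // z pz.
have [y [py by1 cy]] := exists_basic_le W d c s z ds pz.
have [Qy yE] := solE y py by1.
by apply: le_trans cy; rewrite -[in leRHS]yE; apply: Smin.
Qed.

(** * Proximity of optimal solutions *)

Lemma addr_ge0_splits (a b h : R) : 0 <= a -> 0 <= a + b ->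
  `|h| + `|b - h| = `|b| -> 0 <= a + h.
Proof.
by move=> a0 ab; case: (ger0P h); case: (ger0P b); case: (ger0P (b - h)); lra.
Qed.

Lemma primal_proximity W c d d' x' s :
    (exists x, primal_feasible W d x) -> pd_optimal W d' c x' s ->
  exists x, primal_optimal W d c x /\
    forall i, `|x 0 i - x' 0 i| <= (kappa W + 1) * l1norm (d - d').
Proof.
move=> [x1 px1] [px' ds sx'].
have [x2 [px2 x2min]] := exists_primal_optimal W d c x1 s px1 ds.
have [h [hW hs hirr]] := splits_cancel W (x2 - x').
have [x2W x20] := px2; have [x'W x'0] := px'.
have x'h : nonneg (x' + h).
  move=> i; rewrite mxE; have := hs i; rewrite !mxE.
  by apply: addr_ge0_splits => //; rewrite addrCA subrr addr0.
have ch : 0 <= dot c h.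
  rewrite (dual_feasible_dot _ _ _ _ ds hW).
  have := dot_ge0 s (x' + h) (proj2 ds) x'h.
  by rewrite dotDr [dot s x']dotC sx' add0r.
have px : primal_feasible W d (x2 - h).
  apply: primal_feasibleD => //; first by rewrite rpredN.
  move=> i; rewrite !mxE; have := hs i; rewrite !mxE => hsi.
  have -> : x2 0 i - h 0 i = x' 0 i + ((x2 0 i - x' 0 i) - h 0 i) by lra.
  apply: (addr_ge0_splits _ (x2 0 i - x' 0 i)) => //.
    by rewrite addrCA subrr addr0.
  by rewrite opprB addrCA subrr addr0 addrC.
exists (x2 - h); split.
  split => // y py; apply: le_trans (x2min y py).
  by rewrite dotBr gerBl.
move=> i.
have wW : x2 - x' - h - (d - d') \in W.
  have -> : x2 - x' - h - (d - d') = (x2 - d) - (x' - d') - h.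
    by apply/rowP => k; rewrite !mxE; ring.
  by rewrite rpredB // rpredB.
have := irreducible_bound W _ _ wW hirr i.
rewrite subKr.
by rewrite !mxE addrAC.
Qed.

(** * Rounding along circuits *)

Lemma cl_exchange W I j : j \in cl W I -> j \notin I ->
  exists g, [/\ g \in W, g 0 j = 1, supp g \subset j |: I
              & forall i, `|g 0 i| <= kappa W].
Proof.
move=> jcl jI; move: jcl; rewrite !inE (negbTE jI) /=.
move=> /exists_inP[C Cc /andP[jC CI]].
have [[g gW gC] _] := circuits_min W C Cc.
have gj : j \in supp g by rewrite gC.
have gj0 : g 0 j != 0 by rewrite -mem_supp.
exists ((g 0 j)^-1 *: g); split.
- by rewrite rpredZ.
- by rewrite mxE mulVf.
- apply: subset_trans CI; rewrite -gC; apply/subsetP => i.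
  by rewrite !mem_supp mxE mulf_eq0 negb_or => /andP[].
- move=> i; rewrite mxE normrM normfV mulrC ler_pdivrMr ?normr_gt0 //.
  by apply: kappa_bound => //; rewrite gC.
Qed.

End Conformal.

Theorem theorem3p6 (R : realType) (n : nat) (W : {vspace 'rV[R]_n})
    (c d d' x' s : 'rV[R]_n) (tau T : R)
    (feas : pd_feasible W d c)
    (opt : pd_optimal W d' c x' s)
    (htau : (kappa W + 1) * l1norm (d - d') <= tau)
    (hT : (2 * n%:R * kappa W + 1) * tau <= T) :
  exists x'' : 'rV[R]_n,
    [/\ primal_optimal W d c x'',
        forall i, i \in I_L x' T :|: I_M x' tau T -> 0 < x'' 0 i
      & forall i, i \in I_S0 W x' tau T -> x'' 0 i = 0].
Proof.
have k1 := kappa_ge1 _ _ W; have k0 : 0 <= kappa W := le_trans ler01 k1.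
have tau0 : 0 <= tau.
  by apply: le_trans htau; rewrite mulr_ge0 ?addr_ge0 ?sumr_ge0.
have nk0 : 0 <= 2 * n%:R * kappa W * tau by rewrite !mulr_ge0.
have tauT : tau <= T by move: hT; rewrite mulrDl mul1r; lra.
have [x [[px xmin] xprox]] := primal_proximity _ _ W c d d' x' s (proj1 feas) opt.
have [xW x0] := px; have [_ ds sx'] := opt.
have near i : x' 0 i - tau <= x 0 i <= x' 0 i + tau.
  by have := le_trans (xprox i) htau; rewrite ler_norml; lra.
set L := I_L x' T; set S0 := I_S0 W x' tau T.
have S0L j : j \in S0 -> j \notin L.
  by rewrite !inE => /andP[jS _]; rewrite -leNgt; lra.
have s0 j : j \in L -> s 0 j = 0.
  rewrite inE => jT.
  have [[_ x'0] [_ sge0] _] := opt.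
  have /eqP := sx'; rewrite psumr_eq0; last by move=> i _; rewrite mulr_ge0.
  move=> /allP/(_ j); rewrite mem_index_enum => /(_ isT) /=.
  rewrite mulf_eq0 => /orP[/eqP xj|/eqP//]; exfalso.
  by move: jT; rewrite xj; lra.
have /choice[g gP] : forall j, exists g, j \in S0 ->
    [/\ g \in W, g 0 j = 1, supp g \subset j |: L
      & forall i, `|g 0 i| <= kappa W].
  move=> j; have [jS|jS] := boolP (j \in S0); last by exists 0.
  have [|g gP] := cl_exchange _ _ W L j _ (S0L j jS).
    by move: jS; rewrite inE => /andP[].
  by exists g.
(* The total correction to [x]; the circuit of [j] meets no other index of
   [S0], so the corrections do not interfere there. *)
pose w := - \sum_(j in S0) x 0 j *: g j.
have wW : w \in W.
  by rewrite rpredN rpred_sum // => j /gP[gW _ _ _]; rewrite rpredZ.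
have wE i : w 0 i = - \sum_(j in S0) x 0 j * g j 0 i.
  by rewrite mxE summxE; congr (- _); apply: eq_bigr => j _; rewrite mxE.
have g_out i j : j \in S0 -> i \notin L -> i != j -> g j 0 i = 0.
  move=> jS iL ij; have [_ _ /subsetP/(_ i) sg _] := gP j jS.
  apply/eqP/negPn/negP => gi; move: sg; rewrite mem_supp => /(_ gi).
  by rewrite in_setU1 (negbTE ij) (negbTE iL).
have xS0 i : i \in S0 -> (x + w) 0 i = 0.
  move=> iS; rewrite mxE wE (bigD1 i) //= big1 => [|j /andP[jS ji]].
    by have [_ -> _ _] := gP i iS; rewrite mulr1 addr0 subrr.
  by rewrite g_out ?mulr0 ?S0L // eq_sym.
have xrest i : i \notin L -> i \notin S0 -> (x + w) 0 i = x 0 i.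
  move=> iL iS; rewrite mxE wE big1 ?oppr0 ?addr0 // => j jS.
  by rewrite g_out ?mulr0 //; apply: contraNneq iS => ->.
have xL i : i \in L -> 0 < (x + w) 0 i.
  rewrite inE => iT; rewrite mxE wE.
  (* Each of the at most [n] indices of [S0] contributes at most
     [2 * tau * kappa W], while [T - tau < x 0 i]. *)
  have : \sum_(j in S0) x 0 j * g j 0 i <= \sum_(j < n) 2 * tau * kappa W.
    rewrite big_mkcond /=; apply: ler_sum => j _; case: ifP => [jS|_]; last first.
      by rewrite !mulr_ge0.
    have [_ _ _ /(_ i) gi] := gP j jS.
    apply: le_trans (_ : x 0 j * kappa W <= _).
      by rewrite ler_wpM2l ?(le_trans (ler_norm _) gi).
    rewrite ler_wpM2r //.
    by move: jS; rewrite !inE => /andP[jS _]; have := near j; lra.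
  rewrite sumr_const card_ord -[_ *+ n]mulr_natr.
  have := near i; move: hT.
  have -> : (2 * n%:R * kappa W + 1) * tau = 2 * tau * kappa W * n%:R + tau by ring.
  lra.
have xw0 : nonneg (x + w).
  move=> i; have [/xL/ltW//|iL] := boolP (i \in L).
  by have [/xS0->//|iS] := boolP (i \in S0); rewrite xrest.
exists (x + w); split.
- split; first exact: primal_feasibleD.
  move=> y py; apply: le_trans (xmin y py).
  rewrite dotDr gerDl (dual_feasible_dot _ _ _ _ _ _ ds wW) dotNr oppr_le0.
  rewrite dot_sumr; apply: sumr_ge0 => j jS; rewrite dotZr mulr_ge0 //.
  have [_ gj _ _] := gP j jS.
  rewrite /dot (bigD1 j) //= gj mulr1 big1 ?addr0; first by case: ds.
  move=> i ij; have [/s0->|iL] := boolP (i \in L); first by rewrite mul0r.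
  by rewrite g_out ?mulr0.
- move=> i; rewrite inE => /orP[/xL//|iM].
  have [/xL//|iL] := boolP (i \in L); rewrite xrest //.
    by have := near i; move: iM; rewrite inE; lra.
  by apply/negP => /[!inE] /andP[iS _]; move: iM; rewrite inE; lra.
- exact: xS0.
Qed.
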